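(* Let $d\in\mathbb{N}$, let $\{X_{\mathbf n}:\mathbf n\in\mathbb{Z}^d\}$ be a stationary real-valued random field and let $G$ be a continuous distribution function on $\mathbb{R}$. Then $G$ is a phantom distribution function for $\{X_{\mathbf n}\}$ if and only if, for every monotone curve $\boldsymbol\psi$ in $\mathbb{N}^d$, $G$ is a phantom distribution function for $\{X_{\mathbf n}\}$ along $\boldsymbol\psi$.
   Context: $\mathbb{N}=\{1,2,\ldots\}$; $\le$ on $\mathbb{Z}^d$ is the coordinatewise partial order; $\mathbf 1=(1,\ldots,1)$. A random field is stationary if its finite-dimensional distributions are invariant under translations of $\mathbb{Z}^d$. For $\mathbf n\in\mathbb{N}^d$, $M_{\mathbf n}=\max\{X_{\mathbf k}:\mathbf 1\le\mathbf k\le\mathbf n\}$ and $\mathbf n^*=n_1n_2\cdots n_d$. The notation $\mathbf n\to\boldsymbol\infty$ means that every coordinate of $\mathbf n$ tends to infinity. A distribution function $G$ is a phantom distribution function for $\{X_{\mathbf n}\}$ if $\sup_{x\in\mathbb{R}}|P(M_{\mathbf n}\le x)-G(x)^{\mathbf n^*}|\to0$ as $\mathbf n\to\boldsymbol\infty$ (coordinatewise). A monotone curve in $\mathbb{N}^d$ is a map $\boldsymbol\psi:\mathbb{N}\to\mathbb{N}^d$ such that $\boldsymbol\psi(n)\to\boldsymbol\infty$, $\boldsymbol\psi(n)\le\boldsymbol\psi(n+1)$ and $\boldsymbol\psi(n)\ne\boldsymbol\psi(n+1)$ for all $n$, and $\boldsymbol\psi(n)^*/\boldsymbol\psi(n+1)^*\to1$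 as $n\to\infty$. $G$ is a phantom distribution function for $\{X_{\mathbf n}\}$ along $\boldsymbol\psi$ if $\sup_{x\in\mathbb{R}}|P(M_{\boldsymbol\psi(n)}\le x)-G(x)^{\boldsymbol\psi(n)^*}|\to0$ as $n\to\infty$. *)

(* Defs.v *)
From HB Require Import structures.
From mathcomp Require Import all_boot all_order all_algebra.
From mathcomp Require Import all_classical all_reals all_analysis.
Set Implicit Arguments.
Unset Strict Implicit.
Unset Printing Implicit Defensive.
Import Order.TTheory GRing.Theory Num.Theory.
Import numFieldNormedType.Exports.
Local Open Scope classical_set_scope.
Local Open Scope ring_scope.

(* Points of Z^d are {ffun 'I_d -> int}; points of N^d, N = {1, 2, ...}, are
   {ffun 'I_d -> nat} subject to [pos_index]. *)
Definition pos_index (d : nat) (n : {ffun 'I_d -> nat}) : Prop :=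
  forall i, (0 < n i)%N.

(* written n^* in the literature, n^* = n_1 n_2 ... n_d *)
Definition vol (d : nat) (n : {ffun 'I_d -> nat}) : nat :=
  (\prod_(i < d) n i)%N.

Definition one_index (d : nat) : {ffun 'I_d -> int} := [ffun=> 1].

(* {k in Z^d : 1 <= k <= n} *)
Definition box (d : nat) (n : {ffun 'I_d -> nat}) : set {ffun 'I_d -> int} :=
  [set k | forall i, (1 <= k i) && (k i <= (n i)%:Z)].

(* The filter "n -> infinity", every coordinate tending to infinity.  It
   contains [pos_index], so values at indices outside N^d do not matter. *)
Definition index_oo (d : nat) : set_system {ffun 'I_d -> nat} :=
  filter_from [set: nat]
    (fun N : nat => [set n : {ffun 'I_d -> nat} | forall i, (N <= n i)%N]).

Global Instance index_oo_filter (d : nat) : Filter (@index_oo d).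
Proof.
apply: filter_from_filter; first by exists 0%N.
move=> M N _ _; exists (maxn M N) => // n /= MNn; split=> i.
  exact: leq_trans (leq_maxl M N) (MNn i).
exact: leq_trans (leq_maxr M N) (MNn i).
Qed.

Section phantom_df.
Context (d : nat) (R : realType) (disp : measure_display)
  (T : measurableType disp) (P : probability T R).
Implicit Types (X : {ffun 'I_d -> int} -> {RV P >-> R}) (G : R -> R).

Definition stationary X : Prop :=
  forall (m : nat) (k : m.-tuple {ffun 'I_d -> int}) (h : {ffun 'I_d -> int})
    (A : set (m.-tuple R)), measurable A ->
  P [set w | A (map_tuple (fun p => X (p + h) w) k)] =
  P [set w | A (map_tuple (fun p => X p w) k)].

(* M_n for n in N^d.  The default X_1 is one of the terms when n is in N^d;
   see [fmax_attained] and [fmax_ub]. *)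
Definition fmax X (n : {ffun 'I_d -> nat}) (w : T) : R :=
  \big[Num.max/X (one_index d) w]_(k \in box n) X k w.

(* sup over x of |P(M_n <= x) - G(x)^v|, with v = n_1 ... n_d *)
Definition phantom_dist X G (n : {ffun 'I_d -> nat}) : R :=
  sup [set `|fine (P [set w | fmax X n w <= x]) - G x ^+ vol n|
      | x in [set: R]].

Definition phantom_df X G : Prop :=
  phantom_dist X G n @[n --> @index_oo d] --> (0 : R).

Definition phantom_df_along X G (psi : nat -> {ffun 'I_d -> nat}) : Prop :=
  phantom_dist X G (psi n) @[n --> \oo] --> (0 : R).

End phantom_df.

(* The parameter n starts from 0 instead of 1; every condition is invariant
   under this shift. *)
Record monotone_curve (d : nat) (R : realType)
    (psi : nat -> {ffun 'I_d -> nat}) : Prop := MonotoneCurve {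
  curve_pos : forall n, pos_index (psi n) ;
  curve_cvg : psi n @[n --> \oo] --> @index_oo d ;
  curve_le : forall n i, (psi n i <= psi n.+1 i)%N ;
  curve_neq : forall n, psi n <> psi n.+1 ;
  curve_ratio :
    (vol (psi n))%:R / (vol (psi n.+1))%:R @[n --> \oo] --> (1 : R) }.
Arguments monotone_curve d R psi : clear implicits.

Lemma finite_box (d : nat) (n : {ffun 'I_d -> nat}) : finite_set (box n).
Proof.
pose N := (\max_(i < d) n i)%N.
pose f (u : {ffun 'I_d -> 'I_N.+1}) : {ffun 'I_d -> int} :=
  [ffun i => (u i : nat)%:Z].
apply: (@sub_finite_set _ _ (f @` setT)); last first.
  exact/finite_image/finite_finset.
move=> k kn; exists [ffun i => inord `|k i|%N] => //.
apply/ffunP => i; rewrite !ffunE inordK.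
  by have /andP[k1 _] := kn i; rewrite gez0_abs// (le_trans _ k1).
have /andP[k1 kni] := kn i.
rewrite ltnS (@leq_trans (n i))//; last exact: (leq_bigmax i).
by rewrite -lez_nat gez0_abs// (le_trans _ k1).
Qed.

Lemma box_one_index (d : nat) (n : {ffun 'I_d -> nat}) :
  pos_index n -> box n (one_index d).
Proof. by move=> n0 i; rewrite ffunE lexx lez_nat n0. Qed.

Section fmax_lemmas.
Context (d : nat) (R : realType) (disp : measure_display)
  (T : measurableType disp) (P : probability T R)
  (X : {ffun 'I_d -> int} -> {RV P >-> R}).

Lemma fmax_attained n w : pos_index n ->
  exists2 k, box n k & fmax X n w = X k w.
Proof.
move=> n0; rewrite /fmax big_seq.
apply: (big_ind (fun y => exists2 k, box n k & y = X k w)).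
- by exists (one_index d) => //; exact: box_one_index.
- move=> _ _ [k nk ->] [l nl ->].
  by case: (leP (X k w) (X l w)) => _; [exists l|exists k].
- move=> k; case: finite_supportP => // s sP _ _ ks.
  by exists k => //; exact: sP.
Qed.

Lemma fmax_ub n w k : box n k -> X k w <= fmax X n w.
Proof.
move=> nk; rewrite /fmax.
have [->|kN1] := eqVneq (X k w) (X (one_index d) w).
  exact: bigmax_ge_id.
apply: (@le_bigmax_seq _ _ _ _ _ k xpredT (fun k => X k w)) => //.
rewrite in_finite_support.
  by rewrite inE; split => //= /eqP; rewrite (negbTE kN1).
by apply: (sub_finite_set _ (finite_box n)) => ? [].
Qed.

End fmax_lemmas.

(* Main.v *)
Require Import Defs.
From mathcomp Require Import all_boot all_order all_algebra.
From mathcomp Require Import all_classical all_reals all_analysis.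
Import Order.TTheory GRing.Theory Num.Theory.
Import numFieldNormedType.Exports.
Local Open Scope classical_set_scope.
Local Open Scope ring_scope.

(* If the distance does not tend to 0 as n -> oo, there are arbitrarily large
   indices at which it stays away from 0.  A lattice path that increases one
   coordinate by 1 at each step can be led through infinitely many of them, and
   it is a monotone curve: a step raising n_i to n_i + 1 changes the volume by
   the factor (n_i + 1) / n_i, which tends to 1. *)

Section lattice_walk.
Context (d : nat).
Local Notation index := {ffun 'I_d -> nat}.
Implicit Types (p t : index) (n m N : nat).

Definition incr_index p (i : 'I_d) : index := [ffun j => (p j + (j == i))%N].

Lemma incr_index_neq p i : p <> incr_index p i.
Proof.
move=> /ffunP/(_ i); rewrite ffunE eqxx addn1 => /eqP.
by rewrite eq_sym (gtn_eqF (ltnSn _)).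
Qed.

Lemma sum_incr_index p i :
  (\sum_j incr_index p i j = (\sum_j p j).+1)%N.
Proof.
under eq_bigr do rewrite ffunE.
rewrite big_split/= (bigD1 (P := xpredT) i (F := fun j => nat_of_bool (j == i)))//=.
by rewrite eqxx [X in (1 + X)%N]big1 ?addn0 ?addn1// => j /negbTE ->.
Qed.

Lemma vol_incr_index p i :
  (vol (incr_index p i) * p i = vol p * (p i).+1)%N.
Proof.
rewrite /vol (bigD1 i)//= [in RHS](bigD1 i)//= ffunE eqxx addn1.
rewrite (eq_bigr p) => [|j /negbTE ji]; last by rewrite ffunE ji addn0.
by rewrite mulnAC [RHS]mulnAC [in RHS](mulnC (p i)).
Qed.

Context (d_gt0 : (0 < d)%N) (f : nat -> index)
  (f_ge : forall N i, (N <= f N i)%N).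

(* A state is a position and a target; once the target is reached, it is
   replaced by a point of the range of f beyond it in every coordinate. *)
Definition next_target (s : index * index) : index :=
  if s.1 == s.2 then f (\sum_i s.1 i).+1 else s.2.

Definition walk_step (s : index * index) : index * index :=
  let t := next_target s in
  (if [pick i | (s.1 i < t i)%N] is Some i then incr_index s.1 i else s.1, t).

(** The all-ones point keeps every position in N^d. Being also the first target, it counts as
    reached, so the first step already replaces it. *)
Definition walk n : index * index :=
  iter n walk_step ([ffun=> 1%N], [ffun=> 1%N]).

Lemma next_target_gt p t i : p = t -> (p i < next_target (p, t) i)%N.
Proof.
move=> <-; rewrite /next_target/= eqxx.
(* The coordinate sum bounds each coordinate; its successor makes the inequality strict. *)
by apply: leq_trans (f_ge _ i); rewrite ltnS (bigD1 i)//= leq_addr.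
Qed.

Lemma next_target_ge p t i :
  (forall j, (p j <= t j)%N) -> (t i <= next_target (p, t) i)%N.
Proof.
move=> pt; have [ptE|ptN] := eqVneq p t.
  by rewrite -[in leqLHS]ptE ltnW// next_target_gt.
by rewrite /next_target/= (negbTE ptN).
Qed.

Lemma next_target_exists p t : (forall j, (p j <= t j)%N) ->
  exists i, (p i < next_target (p, t) i)%N.
Proof.
move=> pt; have [ptE|ptN] := eqVneq p t.
  by exists (Ordinal d_gt0); exact: next_target_gt.
apply: contrapT => /forallNP pge; move/eqP: ptN; apply; apply/ffunP => i.
apply/eqP; rewrite eqn_leq pt/= leqNgt; apply/negP => pti; apply: (pge i).
exact: leq_trans pti (next_target_ge _ _ i pt).
Qed.

(** Below its target the walk never stalls: the [None] branch of [walk_step] is unreachable. *)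
Lemma walk_step_incr p t : (forall j, (p j <= t j)%N) ->
  exists2 i, (p i < next_target (p, t) i)%N &
    (walk_step (p, t)).1 = incr_index p i.
Proof.
move=> pt; rewrite /walk_step/=; case: pickP => [i ?|pN]; first by exists i.
by have [i] := next_target_exists _ _ pt; rewrite pN.
Qed.

(** This is the invariant of the walk: only a coordinate strictly below the target is raised, and
    only by 1, so no step overshoots. *)
Lemma walk_le_target n i : ((walk n).1 i <= (walk n).2 i)%N.
Proof.
elim: n i => [i|n IH j]; first by rewrite !ffunE.
rewrite /walk iterS -/(walk n); case: (walk n) IH => p t IH.
have [i pi ->] := walk_step_incr _ _ IH; rewrite ffunE.
have [->|_] := eqVneq j i; first by rewrite addn1.
by rewrite addn0; apply: leq_trans (IH j) (next_target_ge _ _ j IH).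
Qed.

Lemma walkS n : exists i, (walk n.+1).1 = incr_index (walk n).1 i.
Proof.
have := walk_le_target n; rewrite /walk iterS -/(walk n).
by case: (walk n) => p t /(walk_step_incr p t)[i _ ->]; exists i.
Qed.

Lemma walk_leS n i : ((walk n).1 i <= (walk n.+1).1 i)%N.
Proof. by have [j ->] := walkS n; rewrite ffunE leq_addr. Qed.

Lemma walk_le n m i : (n <= m)%N -> ((walk n).1 i <= (walk m).1 i)%N.
Proof.
by apply: (homo_leq (f := fun n => (walk n).1 i) leqnn leq_trans) => k;
  exact: walk_leS.
Qed.

Lemma target_le n m i : (n <= m)%N -> ((walk n).2 i <= (walk m).2 i)%N.
Proof.
apply: (homo_leq (f := fun n => (walk n).2 i) leqnn leq_trans) => k.
have := walk_le_target k; rewrite /walk iterS -/(walk k).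
by case: (walk k) => p t /=; exact: next_target_ge.
Qed.

(** The index is [n.+1] because the initial target need not be a value of [f]. *)
Lemma target_range n : range f (walk n.+1).2.
Proof.
elim: n => [|n IH]; first by rewrite /= /next_target/= eqxx; eexists.
rewrite /walk iterS -/(walk n.+1) /= /next_target.
by case: ifP => // _; eexists.
Qed.

Lemma walk_hits n : exists2 m, (n <= m)%N & (walk m).1 = (walk m).2.
Proof.
(* Induction on a strict bound [k] for the gap between the coordinate sums of target and position:
   until a hit, the target is fixed and each step closes the gap by 1. *)
have [k] : exists k, (\sum_i (walk n).2 i < \sum_i (walk n).1 i + k)%N.
  by exists (\sum_i (walk n).2 i).+1; rewrite addnS ltnS leq_addl.
elim: k n => [n|k IH n nk].
  rewrite addn0 ltnNge => /negP[]; apply: leq_sum => i _.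
  exact: walk_le_target.
have [|/eqP nN] := eqVneq (walk n).1 (walk n).2; first by exists n.
have [|m nm mE] := IH n.+1; last by exists m => //; exact: ltnW.
have [i ->] := walkS n; rewrite sum_incr_index addSnnS.
by rewrite /walk iterS -/(walk n) /= /next_target; move/eqP/negbTE: nN => ->.
Qed.

Lemma walk_unbounded N : exists n, forall i, (N <= (walk n).1 i)%N.
Proof.
elim: N => [|N [n Nn]]; first by exists 0%N.
(* At the first hit the target moves strictly beyond the position in every coordinate; by the second
   hit the walk has caught up, so every coordinate has grown. *)
have [m nm mE] := walk_hits n; have [k mk kE] := walk_hits m.+1.
exists k => i; rewrite kE (leq_trans _ (target_le _ _ _ mk))//.
apply: leq_ltn_trans (Nn i) _; apply: leq_ltn_trans (walk_le _ _ i nm) _.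
rewrite /walk iterS -/(walk m) /=.
by case: (walk m) mE => p t /= pt; exact: next_target_gt.
Qed.

Lemma walk_cvg : (walk n).1 @[n --> \oo] --> @index_oo d.
Proof.
move=> A [N _ NA]; have [n Nn] := walk_unbounded N.
exists n => // m /= nm; apply: NA => i /=.
exact: leq_trans (Nn i) (walk_le _ _ i nm).
Qed.

Lemma walk_pos n : pos_index (walk n).1.
Proof. by move=> i; apply: leq_trans (walk_le _ _ i (leq0n n)); rewrite ffunE. Qed.

Lemma walk_monotone_curve (R : realType) :
  monotone_curve d R (fun n => (walk n).1).
Proof.
split; [exact: walk_pos|exact: walk_cvg|exact: walk_leS| |].
  by move=> n; have [i ->] := walkS n; exact: incr_index_neq.
apply/cvgrPdist_lt => e e0.
have [N _ Ne] := near_infty_natSinv_lt (PosNum e0).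
have [n0 Nn0] := walk_unbounded N.
exists n0 => // n /= n0n; have [i nE] := walkS n.
set p := (walk n).1 in nE *; set q := (walk n.+1).1 in nE *.
have Np : (N <= p i)%N := leq_trans (Nn0 i) (walk_le _ _ i n0n).
have vq : (vol q)%:R != 0 :> R.
  by rewrite pnatr_eq0 -lt0n prodn_gt0// => j; exact: walk_pos.
(* Only coordinate [i] changes, so the volume ratio is p_i / (p_i + 1). *)
suff -> : 1 - (vol p)%:R / (vol q)%:R = (p i).+1%:R^-1 :> R.
  by rewrite ger0_norm ?invr_ge0//; exact: (Ne (p i)).
have pi0 : (p i).+1%:R != 0 :> R by rewrite pnatr_eq0.
have -> : (vol p)%:R / (vol q)%:R = (p i)%:R / (p i).+1%:R :> R.
  apply/eqP; rewrite eqr_div// -!natrM eqr_nat.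
  by rewrite -vol_incr_index nE mulnC.
by rewrite -[X in X - _](divff pi0) -mulrBl -natrB// subSnn div1r.
Qed.

Lemma walk_frequently n : exists2 m, (n <= m)%N & range f (walk m).1.
Proof.
(* Asking for a hit from [n.+1] on rules out time 0, where the initial target is hit. *)
have [m nm mE] := walk_hits n.+1; exists m; first exact: ltnW.
by rewrite mE; case: m nm {mE} => // m _; exact: target_range.
Qed.

End lattice_walk.

Lemma cvg_monotone_curves (d : nat) (R : realType) (U : nbhsType)
    (g : {ffun 'I_d -> nat} -> U) (l : U) : (0 < d)%N ->
  (forall psi, monotone_curve d R psi -> g (psi n) @[n --> \oo] --> l) ->
  g n @[n --> @index_oo d] --> l.
Proof.
move=> d_gt0 gl A lA; apply: contrapT => gA.
(* If [A] fails to contain [g n] for all large [n], then beyond each [N] there is a bad index [f N];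
   the walk visits bad indices at arbitrarily late times. *)
have /choice[f fA] : forall N, exists n : {ffun 'I_d -> nat},
    (forall i, (N <= n i)%N) /\ ~ A (g n).
  move=> N; apply: contrapT => /forallNP NA; apply: gA.
  exists N => // n /= Nn; apply: contrapT => An; exact: (NA n).
have f_ge N i : (N <= f N i)%N by have [] := fA N.
have [n _ nA] := gl _ (walk_monotone_curve _ d_gt0 _ f_ge R) A lA.
have [m nm [N _ fNE]] := walk_frequently _ d_gt0 _ f_ge n.
by have [_] := fA N; rewrite fNE; apply; exact: nA.
Qed.

Theorem proposition1p1 (d : nat) (d_gt0 : (0 < d)%N) (R : realType)
    (disp : measure_display) (T : measurableType disp) (P : probability T R)
    (X : {ffun 'I_d -> int} -> {RV P >-> R}) (X_stationary : stationary X)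
    (G : cumulativeBounded (0 : R) (1 : R)) (G_continuous : continuous G) :
  phantom_df X G <->
  (forall psi : nat -> {ffun 'I_d -> nat},
     monotone_curve d R psi -> phantom_df_along X G psi).
Proof.
split=> [XG psi [_ psi_oo _ _ _]|]; last exact: cvg_monotone_curves.
exact: cvg_comp psi_oo XG.
Qed.
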